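(* Let $N\ge1$, let $\lambda=(\lambda_1,\dots,\lambda_N)$ be a partition (zero entries allowed), and let $x^{\pm}=(x_1^{\pm1},\dots,x_N^{\pm1})$. Then $$so_\lambda(x^{\pm})=\sum_{\mu=\lambda-\varepsilon}sp_\mu(x^{\pm}),\qquad o_\lambda(x^{\pm})=\sum_{\mu=\lambda-\varepsilon}(-1)^{|\lambda/\mu|}so_\mu(x^{\pm}),$$ where both sums are over all $\varepsilon=(\varepsilon_1,\dots,\varepsilon_N)\in\{0,1\}^N$ such that $\mu=\lambda-\varepsilon=(\lambda_1-\varepsilon_1,\dots,\lambda_N-\varepsilon_N)$ is a weakly decreasing sequence of nonnegative integers, and $|\lambda/\mu|=|\lambda|-|\mu|$.
   Context: In the $N$ variables $x_1,\dots,x_N$, let $h_n=h_n(x^{\pm})$ be defined by $\prod_{i=1}^N\frac{1}{(1-x_iz)(1-x_i^{-1}z)}=\sum_{n}h_nz^n$ ($h_n=0$ for $n<0$). For a partition $\lambda=(\lambda_1,\dots,\lambda_N)$ (zeros allowed), the odd orthogonal, symplectic and (even) orthogonal characters of the classical groups are given by their Jacobi–Trudi determinants ($1\le i,j\le N$): $so_\lambda(x^{\pm})=\det(h_{\lambda_i-i+j}+h_{\lambda_i-i-j+1})$, $sp_\lambda(x^{\pm})=\det(h_{\lambda_i-i+j}+\delta_{j>1}h_{\lambda_i-i-j+2})$, $o_\lambda(x^{\pm})=\det(h_{\lambda_i-i+j}-h_{\lambda_i-i-j})$, where $\delta_{j>1}$ is $1$ if $j>1$ and $0$ otherwise. *)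

(* Defs.v *)
From mathcomp Require Import all_boot all_order all_algebra.

Set Implicit Arguments.
Unset Strict Implicit.
Unset Printing Implicit Defensive.

Import Order.TTheory GRing.Theory Num.Theory.
Local Open Scope ring_scope.

(* Formal power series in z over R, given by their coefficient sequences. *)

Definition fps_one (R : comUnitRingType) : nat -> R := fun n => (n == 0%N)%:R.

Definition fps_mul (R : comUnitRingType) (f g : nat -> R) : nat -> R :=
  fun n => \sum_(k < n.+1) f k * g (n - k)%N.

(* The power series 1 / (1 - a z); see fps_geomP. *)
Definition fps_geom (R : comUnitRingType) (a : R) : nat -> R :=
  fun n => a ^+ n.

Lemma fps_geomP (R : comUnitRingType) (a : R) (n : nat) :
  fps_mul (fun k => (1 - a *: 'X : {poly R})`_k) (fps_geom a) n = fps_one R n.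
Proof.
rewrite /fps_mul /fps_geom /fps_one big_ord_recl /= subn0.
rewrite coefB coefZ coefX coef1 /= mulr0 subr0 mul1r.
case: n => [|n]; first by rewrite big_ord0 addr0 expr0.
rewrite big_ord_recl big1 => [|i _].
  by rewrite coefB coefZ coefX coef1 /= mulr1 sub0r addr0 subSS subn0 mulNr
             -exprS subrr.
by rewrite coefB coefZ coefX coef1 /= mulr0 subrr mul0r.
Qed.

(* prod_i 1 / ((1 - x_i z) (1 - x_i^-1 z)) *)
Definition hseries (R : comUnitRingType) (N : nat) (x : 'I_N -> R) : nat -> R :=
  \big[@fps_mul R/fps_one R]_(i < N)
     fps_mul (fps_geom (x i)) (fps_geom (x i)^-1).

Definition h (R : comUnitRingType) (N : nat) (x : 'I_N -> R) (n : int) : R :=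
  match n with
  | Posz m => hseries x m
  | Negz _ => 0
  end.

(* Ordinals start at 0, so the paper's row and column indices are i.+1 and
   j.+1. Entries of sequences are integers, so that lambda - epsilon is not
   truncated at 0. *)

Definition so_char (R : comUnitRingType) (N : nat) (x : 'I_N -> R)
    (lam : 'I_N -> int) : R :=
  \det (\matrix_(i < N, j < N)
    (h x (lam i - i.+1%:Z + j.+1%:Z)
     + h x (lam i - i.+1%:Z - j.+1%:Z + 1))).

Definition sp_char (R : comUnitRingType) (N : nat) (x : 'I_N -> R)
    (lam : 'I_N -> int) : R :=
  \det (\matrix_(i < N, j < N)
    (h x (lam i - i.+1%:Z + j.+1%:Z)
     + (1 < j.+1)%N%:R * h x (lam i - i.+1%:Z - j.+1%:Z + 2))).

Definition o_char (R : comUnitRingType) (N : nat) (x : 'I_N -> R)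
    (lam : 'I_N -> int) : R :=
  \det (\matrix_(i < N, j < N)
    (h x (lam i - i.+1%:Z + j.+1%:Z)
     - h x (lam i - i.+1%:Z - j.+1%:Z))).

Definition is_partition (N : nat) (lam : 'I_N -> int) : bool :=
  [forall i, 0 <= lam i] &&
  [forall i : 'I_N, forall j : 'I_N, (i <= j)%N ==> (lam j <= lam i)].

Definition weight (N : nat) (lam : 'I_N -> int) : int := \sum_(i < N) lam i.

(* lambda - epsilon, for epsilon in {0,1}^N *)
Definition sub01 (N : nat) (lam : 'I_N -> int) (eps : {ffun 'I_N -> bool}) :
    'I_N -> int :=
  fun i => lam i - (eps i)%:Z.

(* Main.v *)
(** Multilinearity in the rows turns the sum over all epsilon of the signed
    determinants into one determinant whose columns are, by a telescoping
    identity, consecutive sums (or differences) of columns of the left-hand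
    side.  The epsilon for which lambda - epsilon is not a partition contribute
    0: either lambda - epsilon has an ascent, which produces two equal rows, or
    its last entry is -1, which produces a zero row. *)

Require Import Defs.
From mathcomp Require Import all_boot all_order all_algebra.
From mathcomp Require Import zify ring.

Set Implicit Arguments.
Unset Strict Implicit.
Unset Printing Implicit Defensive.

Import Order.TTheory GRing.Theory Num.Theory.
Local Open Scope ring_scope.

(** In each term of the Leibniz expansion, a product over rows of sums over [I] distributes into a
    sum over the choice functions [f]. *)
Lemma det_row_sum (R : comPzRingType) (n : nat) (I : finType)
    (E : 'I_n -> I -> 'I_n -> R) :
  \det (\matrix_(i, j) \sum_b E i b j) =
  \sum_(f : {ffun 'I_n -> I}) \det (\matrix_(i, j) E i (f i) j).
Proof.
rewrite exchange_big /=; apply: eq_bigr => s _.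
rewrite -big_distrr /=; congr (_ * _).
under eq_bigr do rewrite mxE.
rewrite bigA_distr_bigA; apply: eq_bigr => f _.
by apply: eq_bigr => i _; rewrite mxE.
Qed.

Lemma det_row_scale (R : comPzRingType) (n : nat) (c : 'I_n -> R)
    (A : 'M[R]_n) :
  \det (\matrix_(i, j) (c i * A i j)) = (\prod_i c i) * \det A.
Proof.
have -> : \matrix_(i, j) (c i * A i j) = diag_mx (\row_i c i) *m A.
  by apply/matrixP=> i j; rewrite mul_diag_mx !mxE.
by rewrite det_mulmx det_diag; congr (_ * _); apply: eq_bigr => i _; rewrite mxE.
Qed.

(** The column operation is right multiplication by a unitriangular [U] with [c] on the
    superdiagonal. The factor [(0 < j)] discards the first column, where [j.-1] would be [j]
    itself. *)
Lemma det_add_prev_col (R : comPzRingType) (n : nat) (c : R)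
    (G : 'I_n -> nat -> R) :
  \det (\matrix_(i < n, j < n) (G i j + c * ((0 < j)%N%:R * G i j.-1))) =
  \det (\matrix_(i < n, j < n) G i j).
Proof.
pose U : 'M[R]_n := \matrix_(k, j) ((k == j)%:R + c * (k.+1 == j)%:R).
have detU : \det U = 1.
  rewrite -det_tr det_trig; last first.
    apply/is_trig_mxP=> i j ltij; rewrite !mxE -val_eqE /=.
    by rewrite !gtn_eqF ?mulr0 ?addr0 // ltnW.
  by apply: big1 => i _; rewrite !mxE eqxx gtn_eqF // mulr0 addr0.
rewrite -[RHS]mulr1 -[in RHS]detU -det_mulmx; congr (\det _).
apply/matrixP=> i j; rewrite !mxE.
under [RHS]eq_bigr do rewrite !mxE mulrDr.
rewrite big_split /=; congr (_ + _).
  rewrite (bigD1 j) //= eqxx mulr1 big1 ?addr0 // => k /negPf ->.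
  by rewrite mulr0.
case: j => [[|j] ltj] /=.
  by rewrite mul0r mulr0 big1 // => k _; rewrite !mulr0.
rewrite (bigD1 (Ordinal (ltnW ltj))) //= eqxx big1 ?addr0.
  by rewrite mul1r mulr1 mulrC.
by move=> k; rewrite -val_eqE /= eqSS => /negPf ->; rewrite !mulr0.
Qed.

Lemma not_partition_sub01 (N : nat) (lam : 'I_N -> int)
    (eps : {ffun 'I_N -> bool}) :
  is_partition lam -> ~~ is_partition (sub01 lam eps) ->
  (exists i j : 'I_N, i != j /\
     sub01 lam eps i - i.+1%:Z = sub01 lam eps j - j.+1%:Z) \/
  (exists i : 'I_N, sub01 lam eps i - i.+1%:Z = - N.+1%:Z).
Proof.
move=> /andP[/forallP lam_ge0 /forallP lam_dec] not_part.
have {}lam_dec (i j : 'I_N) : (i <= j)%N -> lam j <= lam i.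
  by move=> leij; have /forallP/(_ j)/implyP := lam_dec i; apply.
pose mu := sub01 lam eps.
have [ascent | no_ascent] :=
  boolP [exists i : 'I_N, exists j : 'I_N, (j == i.+1 :> nat) && (mu i < mu j)].
  left; have /existsP[i /existsP[j /andP[/eqP ji ltmu]]] := ascent.
  exists i, j; split; first by rewrite -val_eqE /=; lia.
  (* As [lam j <= lam i], the ascent forces [lam i = lam j], [eps i = 1] and [eps j = 0]. Thus
     [mu j = mu i + 1], which the shift by the row index cancels. *)
  move: ltmu; rewrite /mu /sub01; have := lam_dec i j.
  by case: (eps i); case: (eps j); lia.
have mu_dec (k : nat) (i j : 'I_N) : j = (i + k)%N :> nat -> mu j <= mu i.
  elim: k i j => [|k IHk] i j ji.
    by have -> : j = i by apply: val_inj; rewrite /= ji addn0.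
  have ltN : (i + k < N)%N by have := ltn_ord j; lia.
  apply: le_trans (IHk i (Ordinal ltN) erefl); rewrite leNgt.
  apply: contra no_ascent => ltmu; apply/existsP; exists (Ordinal ltN).
  by apply/existsP; exists j; rewrite ltmu andbT /= ji addnS.
right; move: not_part; rewrite negb_and => /orP[|].
  rewrite negb_forall => /existsP[i mui_lt0].
  (* Without ascents the last entry of [mu] is at most the negative [mu i]. It is also at least -1,
     because [lam] is nonnegative, so it equals -1. *)
  have ltN : (N.-1 < N)%N by have := ltn_ord i; lia.
  exists (Ordinal ltN) => /=.
  have := mu_dec (N.-1 - i)%N i (Ordinal ltN).
  have := lam_ge0 (Ordinal ltN); move: mui_lt0; have := ltn_ord i.
  by rewrite /mu /sub01 /=; case: (eps (Ordinal ltN)); case: (eps i) => /=; lia.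
rewrite negb_forall => /existsP[i]; rewrite negb_forall => /existsP[j].
rewrite negb_imply => /andP[leij /negP[]].
by apply: (mu_dec (j - i)%N); rewrite subnKC.
Qed.

Lemma weight_sub01 (N : nat) (lam : 'I_N -> int) (eps : {ffun 'I_N -> bool}) :
  weight lam - weight (sub01 lam eps) = (\sum_i eps i)%N%:Z.
Proof.
rewrite /weight -sumrB -natz natr_sum; apply: eq_bigr => i _.
by rewrite /sub01 natz subKr.
Qed.

(* A row of a Jacobi-Trudi matrix depends on i only through the integer
   lam i - i; column j (numbered from 0) is then a function [F j] of it. *)
Lemma det_vertical_strip (R : comPzRingType) (N : nat) (c : R)
    (F G : nat -> int -> R) (lam : 'I_N -> int) :
  (forall (j : 'I_N) a,
     F j a + c * F j (a - 1) = G j a + c * ((0 < j)%N%:R * G j.-1 a)) ->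
  (forall j : 'I_N, F j (- N.+1%:Z) = 0) ->
  is_partition lam ->
  \det (\matrix_(i < N, j < N) G j (lam i - i.+1%:Z)) =
  \sum_(eps : {ffun 'I_N -> bool} | is_partition (sub01 lam eps))
    c ^+ (\sum_i eps i)%N *
    \det (\matrix_(i < N, j < N) F j (sub01 lam eps i - i.+1%:Z)).
Proof.
move=> FG F0 lam_part.
(* The two values of [b] give the two terms on the left of [FG], so row [i] splits according to
   [eps i], with one factor [c] for each unit removed. *)
pose E (i : 'I_N) (b : bool) (j : 'I_N) :=
  c ^+ b * F j (lam i - b%:Z - i.+1%:Z).
rewrite -(det_add_prev_col c (fun i j => G j (lam i - i.+1%:Z))).
transitivity (\det (\matrix_(i, j) \sum_b E i b j)).
  congr (\det _); apply/matrixP=> i j; rewrite !mxE -FG big_bool /E /=.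
  by rewrite mul1r expr1 addrC subr0 addrAC.
rewrite det_row_sum (bigID (fun eps => is_partition (sub01 lam eps))) /=.
have termE (eps : {ffun 'I_N -> bool}) :
    \det (\matrix_(i, j) E i (eps i) j) = c ^+ (\sum_i eps i)%N *
    \det (\matrix_(i < N, j < N) F j (sub01 lam eps i - i.+1%:Z)).
  rewrite -prodrXr -det_row_scale; congr (\det _).
  by apply/matrixP=> i j; rewrite !mxE.
rewrite [X in _ + X]big1 ?addr0 => [|eps not_part].
  by apply: eq_bigr => eps _.
rewrite termE; have [] := not_partition_sub01 lam_part not_part.
  move=> [i [j [neq_ij eq_ij]]].
  rewrite (determinant_alternate neq_ij) ?mulr0 // => k.
  by rewrite !mxE eq_ij.
move=> [i mui]; rewrite (expand_det_row _ i) [X in _ * X]big1 ?mulr0 // => j _.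
by rewrite mxE mui F0 mul0r.
Qed.

Lemma h_neg (R : comUnitRingType) (N : nat) (x : 'I_N -> R) (n : int) :
  n < 0 -> h x n = 0.
Proof. by case: n. Qed.

Theorem theorem4p1 (R : comUnitRingType) (N : nat) (N_ge1 : (1 <= N)%N)
    (x : 'I_N -> R) (x_unit : forall i, x i \is a GRing.unit)
    (lam : 'I_N -> int) (lam_part : is_partition lam) :
  so_char x lam =
    \sum_(eps : {ffun 'I_N -> bool} | is_partition (sub01 lam eps))
      sp_char x (sub01 lam eps)
  /\
  o_char x lam =
    \sum_(eps : {ffun 'I_N -> bool} | is_partition (sub01 lam eps))
      (-1) ^ (weight lam - weight (sub01 lam eps))
      * so_char x (sub01 lam eps).
Proof.
pose SO (j : nat) (a : int) := h x (a + j.+1%:Z) + h x (a - j.+1%:Z + 1).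
pose SP (j : nat) (a : int) :=
  h x (a + j.+1%:Z) + (1 < j.+1)%N%:R * h x (a - j.+1%:Z + 2).
pose O (j : nat) (a : int) := h x (a + j.+1%:Z) - h x (a - j.+1%:Z).
split.
  rewrite /so_char (det_vertical_strip (c := 1) (F := SP) (G := SO)) //.
  - by apply: eq_bigr => eps _; rewrite expr1n mul1r.
  (* In column 0 the delta factor leaves one term in each [SP], and these two are exactly the terms
     of [SO 0 a]. In later columns the four terms regroup as [SO] in columns [j.+1] and [j]. *)
  - move=> [[|j] /= _] a; rewrite /SP /SO /= ?ltnn ?ltnS.
      rewrite !mul0r !addr0 mulr0 addr0 mul1r; congr (h x _ + h x _); lia.
    rewrite !mul1r.
    have -> : a - 1 + j.+2%:Z = a + j.+1%:Z by lia.
    have -> : a - 1 - j.+2%:Z + 2 = a - j.+2%:Z + 1 by lia.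
    have -> : a - j.+2%:Z + 2 = a - j.+1%:Z + 1 by lia.
    by ring.
  (* At [a = - N.+1] the indices of [h] are [j - N] and [- N - j], both negative since [j < N]. *)
  - move=> j; have ltj := ltn_ord j; rewrite /SP h_neg ?add0r; last by lia.
    by rewrite h_neg ?mulr0 //; lia.
rewrite /o_char (det_vertical_strip (c := -1) (F := SO) (G := O)) //.
(* The integer exponent becomes the cast of a natural number, where [^] computes to [^+]. *)
- by apply: eq_bigr => eps _; rewrite weight_sub01.
(* With [c = -1], the two copies of [h x a] cancel in column 0, leaving [O 0 a]. *)
- move=> [[|j] /= _] a; rewrite /SO /O /=.
    have -> : a - 1 + 1 = a by lia.
    have -> : a - 1 - 1 + 1 = a - 1 by lia.
    by ring.
  have -> : a - 1 + j.+2%:Z = a + j.+1%:Z by lia.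
  have -> : a - 1 - j.+2%:Z + 1 = a - j.+2%:Z by lia.
  have -> : a - j.+2%:Z + 1 = a - j.+1%:Z by lia.
  by ring.
- move=> j; have ltj := ltn_ord j; rewrite /SO !h_neg ?addr0 //; lia.
Qed.
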